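(* Let $\mathcal{H}$ and $\mathcal{G}$ be real Hilbert spaces, let $f\in\Gamma_0(\mathcal{H})$, let $g\in\Gamma_0(\mathcal{G})$, and let $L\colon\mathcal{H}\to\mathcal{G}$ be a nonzero bounded linear operator with adjoint $L^*$. Suppose that $0\in\operatorname{ran}(\partial f+L^*\circ\partial g\circ L)$. Consider the primal problem $$\underset{x\in\mathcal{H}}{\text{minimize}}\;\; f(x)+g(Lx)\qquad\text{(P)}$$ and the dual problem $$\underset{v\in\mathcal{G}}{\text{minimize}}\;\; f^*(-L^*v)+g^*(v).\qquad\text{(D)}$$ Let $(x_0,y_0,v_0)\in\mathcal{H}\oplus\mathcal{G}\oplus\mathcal{G}$, let $\varepsilon\in\left]0,1/(1+\sqrt{1+\|L\|^2})\right[$, and let $(\gamma_n)_{n\in\mathbb{N}}$ be a sequence of real numbers such that, for every $n\in\mathbb{N}$, $$\varepsilon\leq\gamma_n\leq\frac{1-\varepsilon}{\sqrt{1+\|L\|^2}}.$$ Iterate, for $n=0,1,\ldots$, $$\begin{aligned} r_n&=\gamma_n(Lx_n-y_n)\\ p_n&=\operatorname{prox}_{\gamma_nf}(x_n-\gamma_nL^*v_n)\\ q_n&=\operatorname{prox}_{\gamma_ng}(y_n+\gamma_nv_n)\\ x_{n+1}&=p_n-\gamma_nL^*r_n\\ y_{n+1}&=q_n+\gamma_nr_n\\ v_{n+1}&=v_n+\gamma_n(Lp_n-q_n). \end{aligned}$$ Then $(x_n)_{n\in\mathbb{N}}$ and $(v_n)_{n\in\mathbb{N}}$ converge weakly to solutions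 to (P) and (D), respectively.
   Context: For a real Hilbert space $\mathcal{X}$: $\Gamma_0(\mathcal{X})$ is the class of lower semicontinuous convex functions $f\colon\mathcal{X}\to\left]-\infty,+\infty\right]$ with $\operatorname{dom}f=\{x\in\mathcal{X}\mid f(x)<+\infty\}\neq\varnothing$. For $f\in\Gamma_0(\mathcal{X})$, the proximity operator $\operatorname{prox}_f\colon\mathcal{X}\to\mathcal{X}$ maps $x$ to the unique minimizer over $y\in\mathcal{X}$ of $f(y)+\frac12\|x-y\|^2$. The conjugate of $f$ is $f^*\colon u\mapsto\sup_{x\in\mathcal{X}}(\langle x\mid u\rangle-f(x))$. The subdifferential of $f$ is $\partial f\colon\mathcal{X}\to 2^{\mathcal{X}}\colon x\mapsto\{u\in\mathcal{X}\mid(\forall y\in\mathcal{X})\ \langle y-x\mid u\rangle+f(x)\leq f(y)\}$. For a set-valued operator $A\colon\mathcal{X}\to 2^{\mathcal{X}}$, $\operatorname{ran}A=\{u\mid(\exists x\in\mathcal{X})\ u\in Ax\}$. $\mathcal{H}\oplus\mathcal{G}\oplus\mathcal{G}$ is the direct Hilbert sum. A solution to a minimization problem is a global minimizer of its objective function. *)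

(* Defs.v *)
From HB Require Import structures.
From mathcomp Require Import all_boot all_order all_algebra.
From mathcomp Require Import all_classical all_reals all_analysis.

Set Implicit Arguments.
Unset Strict Implicit.
Unset Printing Implicit Defensive.

Import Order.TTheory GRing.Theory Num.Theory.
Import numFieldNormedType.Exports.

Local Open Scope classical_set_scope.
Local Open Scope ring_scope.

HB.mixin Record CompleteNormedModule_isHilbert (R : realType) H
    of CompleteNormedModule R H := {
  inner : {dot H for idfun} ;
  inner_norm : forall x : H, inner x x = `|x| ^+ 2 ;
}.

#[short(type="hilbertType")]
HB.structure Definition Hilbert (R : realType) :=
  {H of CompleteNormedModule_isHilbert R H & CompleteNormedModule R H}.

Notation "''<[' x , y ]>" := (inner x%R y%R)
  (at level 0, x at level 99, y at level 99, format "''<[' x ,  y ]>").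

Section convex_analysis.
Context {R : realType} {H : hilbertType R}.
Implicit Types (f : H -> \bar R) (x u : H).

Definition edom f : set H := [set x | (f x < +oo)%E].

Definition convex_efun f := forall x y (t : R), 0 < t < 1 ->
  (f (t *: x + (1 - t) *: y)%R <= t%:E * f x + (1 - t)%:E * f y)%E.

Definition Gamma0 f :=
  [/\ forall x, f x != -oo%E, edom f !=set0, convex_efun f &
      lower_semicontinuous f].

Definition argmin f : set H := [set x | forall y, (f x <= f y)%E].

(* For f in Gamma0 the minimizer exists and is unique; [xget] returns it. The
   value 0 is only taken when there is no minimizer. *)
Definition prox f x : H :=
  xget 0 (argmin (fun y => f y + (2^-1 * `|x - y| ^+ 2)%:E)%E).

Definition conjugate f u : \bar R :=
  ereal_sup [set ('<[x, u]>%:E - f x)%E | x in [set: H]].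

Definition subdifferential f x : set H :=
  [set u | forall y, ('<[y - x, u]>%:E + f x <= f y)%E].

Definition weakly_converges (s : nat -> H) x :=
  forall u, '<[s n, u]> @[n --> \oo] --> '<[x, u]>.

End convex_analysis.

Section set_valued_operators.
Context {X Y Z : Type}.

Definition op_ran (A : X -> set Y) : set Y := [set u | exists x, A x u].

Definition op_add {V : zmodType} (A B : X -> set V) : X -> set V :=
  fun x => [set u + v | u in A x & v in B x].

(* M o A o L, with M and L single-valued. *)
Definition op_comp {T : Type} (M : Z -> T) (A : Y -> set Z) (L : X -> Y) :
  X -> set T := fun x => M @` A (L x).

End set_valued_operators.

Section bounded_operators.
Context {R : realType} {H G : hilbertType R}.

Definition opnorm (L : H -> G) : R :=
  sup [set `|L x| | x in [set x | `|x| <= 1]].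

(* For L linear and bounded, the Riesz representation theorem provides a unique
   such u; it is the value at v of the adjoint of L. *)
Definition adjoint (L : H -> G) (v : G) : H :=
  xget 0 [set u | forall x, '<[L x, v]> = '<[x, u]>].

End bounded_operators.

(* Main.v *)
(** The iteration is Tseng's forward-backward-forward method on H x G x G for
    the sum of the maximally monotone (x, y, v) |-> df(x) x dg(y) x {0} and of
    the skew Lipschitz operator (x, y, v) |-> (L^* v, - v, y - L x).  With
    w_n = v_n + r_n, the points (p_n, q_n, w_n) are the intermediate resolvent
    steps, and for every Kuhn-Tucker pair (a, b) the squared distance from
    (x_n, y_n, v_n) to (a, L a, b) decreases by at least a fixed multiple of
    |x_n - p_n|^2 + |y_n - q_n|^2 + |r_n|^2.  Hence these residuals vanish.
    Weak compactness is used along ultrafilters on nat: a bounded sequence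
    converges weakly along every ultrafilter, because its inner products do and
    Riesz' theorem represents the limiting functional.  Adding the two
    subgradient inequalities at p_n and q_n and passing to the limit, with
    weak lower semicontinuity of f and g, shows that every such limit is a
    Kuhn-Tucker pair, and Opial's argument shows that all these limits agree,
    which gives weak convergence of the whole sequence. *)
Require Import Defs.
From mathcomp Require Import all_boot all_order all_algebra.
From mathcomp Require Import all_classical all_reals all_analysis.
From mathcomp Require Import ring lra.

Set Implicit Arguments.
Unset Strict Implicit.
Unset Printing Implicit Defensive.

Import Order.TTheory GRing.Theory Num.Theory.
Import numFieldNormedType.Exports.

Local Open Scope classical_set_scope.
Local Open Scope ring_scope.

(** * Inner product calculus and the Cauchy-Schwarz inequality *)

Section inner_product.
Context {R : realType} {H : hilbertType R}.
Implicit Types (x y z : H) (a : R).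

Lemma inner_sym x y : '<[x, y]> = '<[y, x]>.
Proof. by rewrite hermC /= expr0 mul1r. Qed.

Lemma innerDl x y z : '<[x + y, z]> = '<[x, z]> + '<[y, z]>.
Proof. exact: linearDl. Qed.

Lemma innerNl x z : '<[- x, z]> = - '<[x, z]>.
Proof. exact: linearNl. Qed.

Lemma innerZl a x z : '<[a *: x, z]> = a * '<[x, z]>.
Proof. exact: linearZl_LR. Qed.

Lemma inner0l z : '<[0, z]> = 0 :> R.
Proof. exact: linear0l. Qed.

Lemma innerDr x y z : '<[z, x + y]> = '<[z, x]> + '<[z, y]>.
Proof. by rewrite inner_sym innerDl !(inner_sym z). Qed.

Lemma innerNr x z : '<[z, - x]> = - '<[z, x]>.
Proof. by rewrite inner_sym innerNl inner_sym. Qed.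

Lemma innerZr a x z : '<[z, a *: x]> = a * '<[z, x]>.
Proof. by rewrite inner_sym innerZl inner_sym. Qed.

Lemma inner0r z : '<[z, 0]> = 0 :> R.
Proof. by rewrite inner_sym inner0l. Qed.

Definition innerE := (innerDl, innerDr, innerNl, innerNr, innerZl, innerZr).

Lemma sqr_normE x : `|x| ^+ 2 = '<[x, x]>.
Proof. by rewrite inner_norm. Qed.

Lemma normr_inner x y : `|'<[x, y]>| <= `|x| * `|y|.
Proof.
have key (u w : H) : 2 * '<[u, w]> <= '<[u, u]> + '<[w, w]>.
  have : 0 <= '<[u - w, u - w]> by rewrite inner_norm sqr_ge0.
  rewrite !innerE (inner_sym w u); lra.
have [->|x0] := eqVneq x 0; first by rewrite inner0l !normr0 mul0r.
have [->|y0] := eqVneq y 0; first by rewrite inner0r !normr0 mulr0.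
have xp : 0 < `|x| by rewrite normr_gt0.
have yp : 0 < `|y| by rewrite normr_gt0.
have xy : 0 < `|x| * `|y| by rewrite mulr_gt0.
(* Rescaling gives both vectors the norm [|x| *]|y|, so that [key], used with both signs, becomes
   Cauchy-Schwarz after division by this product. *)
have := key (`|y| *: x) (`|x| *: y).
have := key (`|y| *: x) (- (`|x| *: y)).
rewrite !innerE !inner_norm ler_norml => k1 k2.
by apply/andP; split; rewrite -(ler_pM2l xy); lra.
Qed.

Lemma sqr_normB_convex a x y z :
  `|z - (a *: x + (1 - a) *: y)| ^+ 2 =
  a * `|z - x| ^+ 2 + (1 - a) * `|z - y| ^+ 2 - a * (1 - a) * `|x - y| ^+ 2.
Proof.
rewrite !sqr_normE !innerE (inner_sym y x) (inner_sym x z) (inner_sym y z).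
ring.
Qed.

End inner_product.

(** * Existence and characterization of proximal points *)

Section proximal.
Context {R : realType} {H : hilbertType R}.
Implicit Types (h : H -> \bar R) (x y z p : H) (a : R).

Definition prox_objective h x y : \bar R := (h y + (2^-1 * `|x - y| ^+ 2)%:E)%E.

Lemma Gamma0_fin h x : Gamma0 h -> (h x < +oo)%E -> h x \is a fin_num.
Proof. by case=> hNoo _ _ _ hx; rewrite fin_numE hNoo lt_eqF. Qed.

Lemma prox_objective_lsc h x : Gamma0 h ->
  lower_semicontinuous (prox_objective h x).
Proof.
move=> [hNoo _ _ hlsc] z a az.
pose q y : R := 2^-1 * `|x - y| ^+ 2.
have qcont : q y @[y --> z] --> q z.
  have dcont : `|x - y| @[y --> z] --> `|x - z|.
    by apply: cvg_norm; apply: cvgB; [exact: cvg_cst|exact: cvg_id].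
  by apply: cvgMr; exact: (cvgM dcont dcont).
(* The margin d is split off so that near z the quadratic term may drop by less than d while h stays
   above [a + d - q z]. *)
have [d d0 adz] : exists2 d : R, 0 < d & ((a + d - q z)%:E < h z)%E.
  move: az; rewrite /prox_objective -/(q z).
  case: (h z) (hNoo z) => [s _| _ _|//]; last by exists 1 => //; rewrite ltry.
  rewrite -EFinD lte_fin => az; exists (2^-1 * (s + q z - a)); first lra.
  by rewrite lte_fin; lra.
have [V zV hV] := hlsc _ _ adz.
exists (V `&` [set y | q z - d < q y]).
  by apply: filterI => //; apply: (cvgr_gt (q z)) => //; lra.
move=> y [/hV Vy /= qy]; rewrite /prox_objective -/(q y).
have : ((a + d - q z)%:E + (q y)%:E < h y + (q y)%:E)%E by rewrite lteD2rE.
by apply: le_lt_trans; rewrite -EFinD lee_fin; lra.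
Qed.

Lemma prox_objective_strongly_convex h x y z a b c :
  Gamma0 h -> 0 < a < 1 ->
  prox_objective h x y = b%:E -> prox_objective h x z = c%:E ->
  (prox_objective h x (a *: y + (1 - a) *: z)%R
   <= (a * b + (1 - a) * c - 2^-1 * (a * (1 - a) * `|y - z| ^+ 2))%:E)%E.
Proof.
move=> [hNoo _ hcvx _] a01; rewrite /prox_objective.
have := hcvx y z _ a01; rewrite sqr_normB_convex.
case: (h y) => [hy| |] //; case: (h z) => [hz| |] //.
rewrite -!EFinM -!EFinD => hle [<-] [<-].
apply: (le_trans (leeD2r _ hle)); rewrite -EFinD lee_fin.
lra.
Qed.

(** Strong convexity makes minimizing sequences Cauchy, and lower semicontinuity makes their limit a
    minimizer. The bound m keeps the infimum finite; it will come from a subgradient or from an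
    explicit estimate. *)
Lemma prox_objective_argmin h x m :
  Gamma0 h -> (forall y, (m%:E <= prox_objective h x y)%E) ->
  argmin (prox_objective h x) !=set0.
Proof.
move=> h0 mle; have [hNoo [y0 hy0] _ _] := h0.
pose F := prox_objective h x.
pose S := [set r : R | exists y, F y = r%:E].
have Sinf : has_inf S.
  split.
    exists (fine (F y0)), y0; rewrite fineK // /F /prox_objective fin_numD.
    by rewrite Gamma0_fin.
  by exists m => r [y Fy]; rewrite -lee_fin -Fy; exact: mle.
pose mu := inf S.
have muF y : (mu%:E <= F y)%E.
  have : (-oo < F y)%E by apply: lt_le_trans (mle y); rewrite ltNyr.
  case Fy: (F y) => [r| |] // _; last by rewrite leey.
  by rewrite lee_fin; apply: ge_inf; [case: Sinf | exists y].
have seq_ex (n : nat) : exists y, exists2 r, F y = r%:E & r < mu + n.+1%:R^-1.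
  have n0 : 0 < n.+1%:R^-1 :> R by rewrite invr_gt0.
  have [r [y Fy] rlt] := inf_adherent n0 Sinf.
  by exists y, r.
have [u hu] := choice seq_ex.
(* The midpoint of two almost minimizers still has value at least mu, which bounds the strong
   convexity gain by their excesses over mu. *)
have udist n k : 8^-1 * `|u n - u k| ^+ 2 <= 2^-1 * (n.+1%:R^-1 + k.+1%:R^-1).
  have [rn Fn ltn] := hu n; have [rk Fk ltk] := hu k.
  have half : 0 < (2^-1 : R) < 1 by lra.
  have := prox_objective_strongly_convex h0 half Fn Fk.
  move=> /(le_trans (muF _)); rewrite lee_fin.
  move: ltn ltk; set a := _^-1; set b := _^-1; lra.
have ucauchy : cauchy (u n @[n --> \oo]).
  apply: cauchy_exP => e e0.
  have e8 : 0 < 8^-1 * e ^+ 2 by rewrite mulr_gt0 // exprn_gt0.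
  have [N _ hN] := near_infty_natSinv_lt (PosNum e8).
  exists (u N); exists N => // n /= Nn; rewrite -ball_normE /=.
  rewrite -(ltr_pXn2r (n := 2)) // ?nnegrE ?(ltW e0) //.
  have := hN N (leqnn N); have := hN n Nn; have := udist N n => /=.
  set a := N.+1%:R^-1; set b := n.+1%:R^-1; lra.
pose z := lim (u n @[n --> \oo]).
have uz : u n @[n --> \oo] --> z by exact: cauchy_cvg.
exists z => y; apply: le_trans (muF y); rewrite leNgt; apply/negP => muz.
have [d d0 mudz] : exists2 d : R, 0 < d & ((mu + d)%:E < F z)%E.
  move: muz; rewrite -/(F z); case: (F z) => [s| _|//].
    rewrite lte_fin => muz; exists (2^-1 * (s - mu)); first lra.
    by rewrite lte_fin; lra.
  by exists 1 => //; rewrite ltry.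
have [V zV hV] := prox_objective_lsc h0 mudz.
near \oo => n.
have Vn : V (u n) by near: n; exact: uz.
have [r Fn rlt] := hu n.
have := hV _ Vn; rewrite -/(F _) Fn lte_fin.
have : n.+1%:R^-1 < d by near: n; exact: near_infty_natSinv_lt (PosNum d0).
by move: rlt; set a := n.+1%:R^-1; lra.
Unshelve. all: end_near.
Qed.

Lemma argmin_prox_objective h x p : Gamma0 h -> argmin (prox_objective h x) p ->
  (h p < +oo)%E /\ subdifferential h p (x - p).
Proof.
move=> h0 pmin; have [hNoo [y0 hy0] _ _] := h0.
have hp : (h p < +oo)%E.
  have := pmin y0; rewrite /prox_objective.
  move: hy0; rewrite /edom /=; case: (h p) => [s||]; rewrite ?ltry //.
  by case: (h y0).
split=> // y.
have [hy|] := ltP (h y) +oo%E; last first.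
  by rewrite leye_eq => /eqP ->; rewrite leey.
have hpE := fineK (Gamma0_fin h0 hp); have hyE := fineK (Gamma0_fin h0 hy).
pose Fp := fine (h p) + 2^-1 * `|x - p| ^+ 2.
pose Fy := fine (h y) + 2^-1 * `|x - y| ^+ 2.
have FpE : prox_objective h x p = Fp%:E by rewrite /prox_objective -hpE.
have FyE : prox_objective h x y = Fy%:E by rewrite /prox_objective -hyE.
rewrite -hpE -hyE -EFinD lee_fin.
suff : Fp <= Fy - 2^-1 * `|y - p| ^+ 2.
  rewrite /Fp /Fy !sqr_normE !innerE.
  rewrite (inner_sym y x) (inner_sym p x) (inner_sym p y).
  lra.
(* Minimality along the segment from p to y, as the step a tends to 0. *)
apply/ler_addgt0Pr => e e0.
pose D := 2^-1 * `|y - p| ^+ 2; rewrite -/D.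
have D0 : 0 <= D by rewrite mulr_ge0 // sqr_ge0.
(* Strong convexity divided by a gives Fp <= Fy - D + a * D; this a lies in ]0, 1[ and makes the
   error a * D at most e. *)
pose a := e / (D + e + 1).
have De : 0 < D + e + 1 by lra.
have a01 : 0 < a < 1.
  by rewrite divr_gt0 //= ltr_pdivrMr // mul1r; lra.
have aD : a * D <= e.
  rewrite /a mulrAC ler_pdivrMr // ler_pM2l //; lra.
have := prox_objective_strongly_convex h0 a01 FyE FpE.
move=> /(le_trans (pmin _)); rewrite FpE lee_fin -/D => hle.
have /andP[a0 a1] := a01.
have : a * Fp <= a * (Fy - D + a * D) by rewrite /D in hle *; nra.
rewrite ler_pM2l //; lra.
Qed.

End proximal.

(** * Weak limits along filters, Riesz representation, weak lower semicontinuity *)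

Section weak_topology.
Context {R : realType}.

(* [weakly_converges] is the case F = \oo. *)
Definition weak_cvg {T : Type} {H : hilbertType R} (F : set_system T)
  (s : T -> H) (x : H) := forall u, '<[s t, u]> @[t --> F] --> '<[x, u]>.

(** Compactness of [-M, M] yields a cluster point, and a cluster point of an ultrafilter is a
    limit. *)
Lemma ultra_bounded_cvg {T : Type} (U : set_system T) (s : T -> R) (M : R) :
  UltraFilter U -> (forall t, `|s t| <= M) ->
  exists l : R, s t @[t --> U] --> l.
Proof.
move=> Uultra sM; have Uproper : ProperFilter U by exact: ultra_proper.
have := @segment_compact R (- M) M (s t @[t --> U]) _ _.
case=> [|l [_ lclu]].
  by apply: (@filterE _ U) => t /=; rewrite in_itv /= -ler_norml.
exists l => B Bl; have [//|UC] := in_ultra_setVsetC (s @^-1` B) Uultra.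
by have [b []] := lclu (~` B) B UC Bl.
Qed.

(* z is the minimizer of y |-> |y|^2 / 2 - phi y. *)
Lemma riesz_representation {H : hilbertType R} (phi : H -> R) (C : R) :
  scalar phi -> (forall x, `|phi x| <= C * `|x|) ->
  exists z, forall x, phi x = '<[x, z]>.
Proof.
move=> phiL phiC.
pose h y := (- phi y)%:E.
have phiB x y : phi (x - y) = phi x - phi y.
  by rewrite addrC -scaleN1r phiL mulN1r addrC.
have phi0 : phi 0 = 0 by rewrite -[X in phi X](subrr 0) phiB subrr.
have h0 : Gamma0 h.
  split=> //.
  - by exists 0; rewrite /edom /= ltry.
  - move=> x y t _; rewrite /h -!EFinM -EFinD lee_fin phiL.
    by rewrite -[_ *: y]addr0 phiL phi0; lra.
  - move=> x a; rewrite lte_fin => ax.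
    pose e := (- phi x - a) / (`|C| + 1).
    have C1 : 0 < `|C| + 1 by rewrite ltr_wpDl.
    exists (ball x e).
      by apply: nbhsx_ballx; rewrite divr_gt0 // subr_gt0.
    move=> y; rewrite -ball_normE /= /e ltr_pdivlMr // lte_fin => xy.
    have := phiC (x - y); rewrite phiB (distrC (phi x)) => /ler_normlW yx.
    have : C * `|x - y| <= `|C| * `|x - y| by rewrite ler_wpM2r // ler_norm.
    have := normr_ge0 (x - y); lra.
(* Completing the square in [|y| ^+ 2 / 2 - C *]|y|. *)
have hle y : ((- (2^-1 * C ^+ 2))%:E <= prox_objective h 0%R y)%E.
  rewrite /prox_objective -EFinD lee_fin sub0r normrN.
  have /ler_normlW := phiC y; have := sqr_ge0 (`|y| - C); nra.
have [z /(argmin_prox_objective h0) [_ hz]] := prox_objective_argmin h0 hle.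
(* The subgradient inequality at w + z gives one bound; linearity, applied to - w, gives the reverse
   one. *)
have phile w : phi w <= '<[w, z]>.
  have := hz (w + z); rewrite -EFinD lee_fin addrK sub0r innerNr.
  have := phiB (w + z) z; rewrite addrK => ->; lra.
exists z => w; apply/le_anti; rewrite phile /=.
have := phile (0 - w); rewrite phiB phi0 !sub0r innerNl; lra.
Qed.

Lemma ultra_weak_cvg {T : Type} {H : hilbertType R} (U : set_system T)
    (s : T -> H) (M : R) :
  UltraFilter U -> (forall t, `|s t| <= M) -> exists x, weak_cvg U s x.
Proof.
move=> Uultra sM; have Uproper : ProperFilter U by exact: ultra_proper.
have bnd u t : `|'<[s t, u]>| <= M * `|u|.
  by apply: le_trans (normr_inner _ _) _; rewrite ler_wpM2r.
have [phi phiP] := choice (fun u => ultra_bounded_cvg Uultra (bnd u)).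
have philin a (u w : H) : phi (a *: u + w) = a * phi u + phi w.
  have lincvg : '<[s t, a *: u + w]> @[t --> U] --> a * phi u + phi w.
    rewrite (_ : (fun t => _) = (fun t => a * '<[s t, u]> + '<[s t, w]>)).
      by apply: cvgD (phiP w); apply: cvgMr; exact: phiP.
    by apply/funext => t; rewrite innerDr innerZr.
  exact: (cvg_unique _ (phiP _) lincvg).
have [x xP] : exists x, forall u, phi u = '<[u, x]>.
  apply: (@riesz_representation _ _ M) => [a u w|u]; first exact: philin.
  apply: (cvgr_to_le (cvg_norm (phiP u))); exact: nearW.
by exists x => u; rewrite inner_sym -xP.
Qed.

(* The prox of the indicator of {f <= c} projects x onto this closed convex set,
   and the s t in it force the projection to be x itself. *)
Lemma weak_lsc {T : Type} {H : hilbertType R} (F : set_system T)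
    (s : T -> H) (x : H) (f : H -> \bar R) (c : R) :
  ProperFilter F -> Gamma0 f -> weak_cvg F s x ->
  (\forall t \near F, (f (s t) <= c%:E)%E) -> (f x <= c%:E)%E.
Proof.
move=> Fproper [fNoo _ fcvx flsc] sx fc.
pose h y : \bar R := if (f y <= c%:E)%E then 0%E else +oo%E.
have h0 : Gamma0 h.
  split.
  - by move=> y; rewrite /h; case: ifP.
  - have [t ft] := filter_ex fc; exists (s t).
    by rewrite /edom /= /h ft ltry.
  - move=> y z t t01; have /andP[t0 t1] := t01; rewrite /h.
    have u0 : 0 < 1 - t by rewrite subr_gt0.
    have [fy|_] := boolP (f y <= c%:E)%E; last first.
      rewrite gt0_muley ?lte_fin // addye ?leey //.
      by case: ifP => _; rewrite ?mule0 ?gt0_muley ?lte_fin.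
    have [fz|_] := boolP (f z <= c%:E)%E; last first.
      by rewrite mule0 add0e gt0_muley ?lte_fin // leey.
    rewrite !mule0 adde0 (le_trans (fcvx y z t t01)) //.
    have -> : c%:E = (t%:E * c%:E + (1 - t)%:E * c%:E)%E.
      by rewrite -!EFinM -EFinD; congr EFin; ring.
    by apply: leeD; apply: lee_wpmul2l => //; rewrite lee_fin ?subr_ge0 ltW.
  - move=> y a; rewrite /h; case: ifPn => [_ a0|].
      exists setT; first exact: filterT.
      by move=> z _; case: ifP => // _; rewrite ltry.
    rewrite -ltNge => /flsc [V yV hV] _; exists V => // z /hV.
    by rewrite ltNge => /negbTE ->; rewrite ltry.
have hle y : (0%:E <= prox_objective h x y)%E.
  apply: adde_ge0; first by rewrite /h; case: ifP.
  by rewrite lee_fin mulr_ge0 // sqr_ge0.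
have [p /(argmin_prox_objective h0) [hp pP]] := prox_objective_argmin h0 hle.
have fp : (f p <= c%:E)%E by move: hp; rewrite /h; case: ifP.
suff : '<[x, x - p]> <= '<[p, x - p]>.
  rewrite -subr_le0 -innerNl -innerDl -sqr_normE => xp.
  have /eqP : `|x - p| ^+ 2 = 0 by apply/le_anti; rewrite xp sqr_ge0.
  by rewrite sqrf_eq0 normr_eq0 subr_eq0 => /eqP ->.
apply: (cvgr_to_le (sx (x - p))); apply: filterS fc => t ft.
have := pP (s t); rewrite /h ft fp adde0 lee_fin innerDl innerNl; lra.
Qed.

End weak_topology.

(** * Operator norm and adjoint *)

Section bounded_linear.
Context {R : realType} {H G : hilbertType R} (L : {linear H -> G}).
Context (Lbounded : bounded_fun_norm L).

Lemma opnorm_ge0 : 0 <= opnorm L.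
Proof.
have [M hM] := Lbounded 1.
apply: (le_trans _ (ub_le_sup (x := `|L 0|) _ _)); first by [].
  by exists M => _ [x x1 <-]; exact: hM.
by exists 0 => //=; rewrite normr0.
Qed.

Lemma ler_opnorm x : `|L x| <= opnorm L * `|x|.
Proof.
have [->|x0] := eqVneq x 0; first by rewrite linear0 !normr0 mulr0.
have xp : 0 < `|x| by rewrite normr_gt0.
rewrite -ler_pdivrMr //.
have [M hM] := Lbounded 1.
apply: ub_le_sup; first by exists M => _ [z z1 <-]; exact: hM.
exists (`|x|^-1 *: x) => /=.
  by rewrite normrZ normfV normr_id mulVf // gt_eqF.
by rewrite linearZ normrZ normfV normr_id mulrC.
Qed.

Lemma inner_adjoint x v : '<[L x, v]> = '<[x, adjoint L v]>.
Proof.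
(* The default value 0 in [adjoint] is excluded by Riesz' theorem for x |-> '<[L x, v]>. *)
rewrite /adjoint; case: xgetP => [u _ -> //|noadj].
have [z zP] : exists z, forall x, '<[L x, v]> = '<[x, z]>.
  apply: (@riesz_representation _ _ _ (opnorm L * `|v|)) => [a y z|y].
    by rewrite linearP innerDl innerZl.
  apply: le_trans (normr_inner _ _) _.
  by rewrite mulrAC ler_wpM2r // ler_opnorm.
by have := noadj z; case.
Qed.

Lemma normr_adjoint v : `|adjoint L v| <= opnorm L * `|v|.
Proof.
have [->|a0] := eqVneq (adjoint L v) 0.
  by rewrite normr0 mulr_ge0 // opnorm_ge0.
have ap : 0 < `|adjoint L v| by rewrite normr_gt0.
rewrite -(ler_pM2l ap) -expr2 sqr_normE -inner_adjoint.
apply: le_trans (ler_norm _) _; apply: le_trans (normr_inner _ _) _.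
by rewrite mulrA [_ * opnorm L]mulrC ler_wpM2r // ler_opnorm.
Qed.

End bounded_linear.

(** * Subgradients, Kuhn-Tucker pairs and duality *)

Section convex_duality.
Context {R : realType}.

Lemma subdifferential_dom {H : hilbertType R} (f : H -> \bar R) (x u : H) :
  Gamma0 f -> subdifferential f x u -> (f x < +oo)%E.
Proof.
move=> [_ [y fy] _ _] /(_ y); rewrite ltey; apply: contraTneq => ->.
by rewrite addey // leye_eq lt_eqF.
Qed.

Lemma Gamma0_scale {H : hilbertType R} (f : H -> \bar R) (c : R) :
  0 < c -> Gamma0 f -> Gamma0 (fun z => (c%:E * f z)%E).
Proof.
move=> c0 [fNoo [y0 fy0] fcvx flsc]; split.
- by move=> x; case: (f x) (fNoo x) => [s||] //; rewrite gt0_muley ?lte_fin.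
- exists y0; move: fy0; rewrite /edom /=; case: (f y0) => [s _|//|_].
    by rewrite -EFinM ltry.
  by rewrite mulrNy gtr0_sg // mul1e.
- move=> x y t t01; have /andP[t0 t1] := t01.
  have /(lee_wpmul2l (x := c%:E)) := fcvx x y t t01.
  rewrite lee_fin => /(_ (ltW c0)) /le_trans; apply.
  have u0 : 0 < 1 - t by rewrite subr_gt0.
  case: (f x) (fNoo x) => [a||] //; case: (f y) (fNoo y) => [b||] // _ _.
  - by rewrite -!EFinM -!EFinD lee_fin; lra.
  - by rewrite !(gt0_muley, addey, addye, leey) ?lte_fin.
  - by rewrite !(gt0_muley, addey, addye, leey) ?lte_fin.
  - by rewrite !(gt0_muley, addey, addye, leey) ?lte_fin.
- move=> x a; rewrite -lte_pdivrMl // -EFinM => /flsc [V xV hV].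
  by exists V => // y /hV; rewrite EFinM lte_pdivrMl.
Qed.

(** The subgradient ub at xb supplies an affine minorant of f. Hence the objective is bounded below,
    a minimizer exists, and [prox] does not take its default value. *)
Lemma prox_subdifferential {H : hilbertType R} (f : H -> \bar R) (c : R)
    (xb ub x : H) :
  0 < c -> Gamma0 f -> subdifferential f xb ub ->
  let p := prox (fun z => (c%:E * f z)%E) x in
  (f p < +oo)%E /\ subdifferential f p (c^-1 *: (x - p)).
Proof.
move=> c0 f0 hub p.
have cf0 := Gamma0_scale c0 f0.
have fxb := fineK (Gamma0_fin f0 (subdifferential_dom f0 hub)).
(* The minimum over y of the affine minorant times c plus the quadratic term, attained where x - y =
   c *: ub. *)
pose m := c * (fine (f xb) + '<[x - xb, ub]>) - 2^-1 * (c ^+ 2 * `|ub| ^+ 2).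
have hm y : (m%:E <= prox_objective (fun z => (c%:E * f z)%E) x y)%E.
  rewrite /prox_objective.
  have /(lee_wpmul2l (x := c%:E)) := hub y.
  rewrite lee_fin -fxb -EFinD -EFinM => /(_ (ltW c0)) hy.
  apply: le_trans (leeD2r _ hy); rewrite -EFinD lee_fin /m.
  have := sqr_ge0 `|x - y - c *: ub|.
  rewrite !sqr_normE !innerE (inner_sym y x) (inner_sym ub x) (inner_sym ub y).
  lra.
have [z zmin] := prox_objective_argmin cf0 hm.
have : argmin (prox_objective (fun z => (c%:E * f z)%E) x) p
  by rewrite /p /prox; apply: xgetPex; exists z.
case/(argmin_prox_objective cf0) => fp pP.
have {}fp : (f p < +oo)%E.
  by move: fp; case: (f p) => [s||] //; rewrite ?ltry // mulry gtr0_sg // mul1e.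
split=> // y; have := pP y.
have [fy _|] := ltP (f y) +oo%E; last first.
  by rewrite leye_eq => /eqP ->; rewrite leey.
have := pP y; rewrite -(fineK (Gamma0_fin f0 fp)) -(fineK (Gamma0_fin f0 fy)).
rewrite -!EFinM -!EFinD !lee_fin innerZr => hy.
by rewrite -(ler_pM2l c0) mulrDr mulrA divff ?gt_eqF // mul1r.
Qed.

Lemma subdifferential_monotone {H : hilbertType R} (f : H -> \bar R)
    (x y u w : H) :
  Gamma0 f -> subdifferential f x u -> subdifferential f y w ->
  0 <= '<[x - y, u - w]>.
Proof.
move=> f0 xu yw.
have fx := fineK (Gamma0_fin f0 (subdifferential_dom f0 xu)).
have fy := fineK (Gamma0_fin f0 (subdifferential_dom f0 yw)).
have := xu y; have := yw x; rewrite -fx -fy -!EFinD !lee_fin !innerE; lra.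
Qed.

Context {H G : hilbertType R} (f : H -> \bar R) (g : G -> \bar R).
Context (L : {linear H -> G}).
Context (hf : Gamma0 f) (hg : Gamma0 g) (Lbounded : bounded_fun_norm L).

(** Equivalently, (x, L x, v) is a zero of the sum of the two operators on H x G x G. *)
Definition kuhn_tucker (x : H) (v : G) :=
  subdifferential f x (- adjoint L v) /\ subdifferential g (L x) v.

Lemma kuhn_tucker_ex :
  op_ran (op_add (subdifferential f)
                 (op_comp (adjoint L) (subdifferential g) L)) 0 ->
  exists x v, kuhn_tucker x v.
Proof.
move=> [x [u fu [_ [v gv <-] /eqP]]]; rewrite addr_eq0 => /eqP uv.
by exists x, v; split=> //; rewrite -uv.
Qed.

(** The linear terms of the two subgradient inequalities at z and L z cancel through the adjoint. *)
Lemma kuhn_tucker_primal x v : kuhn_tucker x v ->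
  argmin (fun z => (f z + g (L z))%E) x.
Proof.
move=> [fx gx] z.
have := leeD (fx z) (gx (L z)); apply: le_trans.
rewrite addeACA -EFinD -linearB /= innerNr inner_adjoint // addNr add0e.
by [].
Qed.

(** Equality case of Fenchel-Young: the subgradient inequality says that the supremum is attained at
    x. *)
Lemma conjugate_subdifferential {K : hilbertType R} (h : K -> \bar R)
    (x u : K) :
  Gamma0 h -> subdifferential h x u -> conjugate h u = ('<[x, u]>%:E - h x)%E.
Proof.
move=> h0 hu; apply/le_anti/andP; split; last first.
  by apply: ereal_sup_ubound; exists x.
apply: ge_ereal_sup => _ [y _ <-].
have hx := fineK (Gamma0_fin h0 (subdifferential_dom h0 hu)).
have := hu y; rewrite -hx -EFinD.
case: (h y) => [s||] //=; rewrite -?EFinD ?lee_fin ?leNye //.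
rewrite !innerE; lra.
Qed.

(** The suprema at v are attained at x and L x, and the same points bound the conjugates at w from
    below. Inner products cancel, so both sums equal - f x - g (L x). *)
Lemma kuhn_tucker_dual x v : kuhn_tucker x v ->
  argmin (fun w => (conjugate f (- adjoint L w)%R + conjugate g w)%E) v.
Proof.
move=> [fx gx] w /=.
rewrite (conjugate_subdifferential hf fx) (conjugate_subdifferential hg gx).
have le1 : ('<[x, - adjoint L w]>%:E - f x <= conjugate f (- adjoint L w)%R)%E.
  by apply: ereal_sup_ubound; exists x.
have le2 : ('<[L x, w]>%:E - g (L x) <= conjugate g w)%E.
  by apply: ereal_sup_ubound; exists (L x).
apply: le_trans (leeD le1 le2).
rewrite -(fineK (Gamma0_fin hf (subdifferential_dom hf fx))).
rewrite -(fineK (Gamma0_fin hg (subdifferential_dom hg gx))).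
by rewrite -!EFinB -!EFinD lee_fin !innerNr -!inner_adjoint //; lra.
Qed.

End convex_duality.

(** * Decrease of the distance to Kuhn-Tucker points in one iteration *)

Section one_step.
Context {R : realType}.

Lemma fbf_identity {H : hilbertType R} (z zt zp zb : H) :
  `|zp - zb| ^+ 2 = `|z - zb| ^+ 2 - `|z - zt| ^+ 2 + `|zt - zp| ^+ 2
                    - 2 * '<[zt - zb, z - zp]>.
Proof.
rewrite !sqr_normE !innerE (inner_sym zb zp) (inner_sym zb z)
  (inner_sym zt zp) (inner_sym zt z).
ring.
Qed.

Context {H G : hilbertType R} (f : H -> \bar R) (g : G -> \bar R).
Context (L : {linear H -> G}).
Context (hf : Gamma0 f) (hg : Gamma0 g) (Lbounded : bounded_fun_norm L).

Lemma fejer_step (xb : H) (vb : G) (c e : R) (x p : H) (y v q r : G) :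
  kuhn_tucker f g L xb vb ->
  0 < e < 1 -> 0 < c -> c <= (1 - e) / Num.sqrt (1 + opnorm L ^+ 2) ->
  subdifferential f p (c^-1 *: (x - c *: adjoint L v - p)) ->
  subdifferential g q (c^-1 *: (y + c *: v - q)) ->
  r = c *: (L x - y) ->
  `|p - c *: adjoint L r - xb| ^+ 2 + `|q + c *: r - L xb| ^+ 2 +
     `|v + c *: (L p - q) - vb| ^+ 2 <=
  `|x - xb| ^+ 2 + `|y - L xb| ^+ 2 + `|v - vb| ^+ 2
    - (1 - (1 - e) ^+ 2) * (`|x - p| ^+ 2 + `|y - q| ^+ 2 + `|r| ^+ 2).
Proof.
move=> [fxb gxb] /andP[e0 e1] c0 cle fp gq rE.
set l := opnorm L in cle *.
have l0 : 0 <= l by exact: opnorm_ge0.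
(* The skew operator has Lipschitz constant at most the square root of 1 + l ^+ 2, so c times it is
   at most 1 - e. *)
have c2 : c ^+ 2 * (1 + l ^+ 2) <= (1 - e) ^+ 2.
  have s0 : 0 < 1 + l ^+ 2 by rewrite ltr_pwDl // sqr_ge0.
  rewrite -[X in _ * X](sqr_sqrtr (ltW s0)) -exprMn.
  rewrite lerXn2r ?nnegrE ?mulr_ge0 ?sqrtr_ge0 ?(ltW c0) //; first lra.
  by rewrite -ler_pdivlMr // sqrtr_gt0.
have M1 := subdifferential_monotone hf fp fxb.
have M2 := subdifferential_monotone hg gq gxb.
set w := v + r.
rewrite (fbf_identity x p (p - _)) (fbf_identity y q (q + _)).
rewrite (fbf_identity v w (v + _)).
have -> : p - (p - c *: adjoint L r) = c *: adjoint L r.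
  by rewrite opprB addrC subrK.
have -> : q - (q + c *: r) = - (c *: r) by rewrite opprD addrA subrr add0r.
have -> : v - w = - r by rewrite /w opprD addrA subrr add0r.
have -> : w - (v + c *: (L p - q)) = c *: (L (x - p) - (y - q)).
  have LB : L (x - p) = L x - L p by exact: linearB.
  rewrite LB /w rE opprD addrACA subrr add0r -scalerBr; congr (_ *: _).
  by rewrite !opprD !opprK addrACA.
have {}M1 : 0 <= '<[p - xb, x - c *: adjoint L v - p - c *: (- adjoint L vb)]>.
  have := mulr_ge0 (ltW c0) M1.
  by rewrite -innerZr scalerBr scalerA divff ?gt_eqF // scale1r.
have {}M2 : 0 <= '<[q - L xb, y + c *: v - q - c *: vb]>.
  have := mulr_ge0 (ltW c0) M2.
  by rewrite -innerZr scalerBr scalerA divff ?gt_eqF // scale1r.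
(* The contribution of the skew operator cancels in M1 + M2. *)
have T : 0 <= '<[p - xb, x - (p - c *: adjoint L r)]>
  + '<[q - L xb, y - (q + c *: r)]> + '<[w - vb, v - (v + c *: (L p - q))]>.
  move: M1 M2; rewrite /w !innerE -!inner_adjoint //.
  rewrite (inner_sym v (L p)) (inner_sym v q) (inner_sym r (L p)).
  rewrite (inner_sym r q) (inner_sym vb (L p)) (inner_sym vb q).
  lra.
have B1 : `|adjoint L r| ^+ 2 <= l ^+ 2 * `|r| ^+ 2.
  by rewrite -exprMn lerXn2r ?nnegrE ?mulr_ge0 // normr_adjoint.
have B2 : `|L (x - p) - (y - q)| ^+ 2
          <= (1 + l ^+ 2) * (`|x - p| ^+ 2 + `|y - q| ^+ 2).
  have tri : `|L (x - p) - (y - q)| <= l * `|x - p| + `|y - q|.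
    by apply: (le_trans (ler_normB _ _)); rewrite lerD2r ler_opnorm.
  have : `|L (x - p) - (y - q)| ^+ 2 <= (l * `|x - p| + `|y - q|) ^+ 2.
    by rewrite lerXn2r ?nnegrE ?addr_ge0 ?mulr_ge0.
  (* Cauchy-Schwarz in the plane: (l a + b)^2 + (l b - a)^2 = (1 + l^2)(a^2 + b^2). *)
  have := sqr_ge0 (l * `|y - q| - `|x - p|); lra.
rewrite !normrN !normrZ !exprMn (gtr0_norm c0).
have : c ^+ 2 * `|adjoint L r| ^+ 2 + c ^+ 2 * `|r| ^+ 2
      + c ^+ 2 * `|L (x - p) - (y - q)| ^+ 2
  <= (1 - e) ^+ 2 * (`|x - p| ^+ 2 + `|y - q| ^+ 2 + `|r| ^+ 2).
  set E := _ + `|r| ^+ 2.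
  have E0 : 0 <= E by rewrite !addr_ge0 // sqr_ge0.
  apply: le_trans (ler_wpM2r E0 c2).
  rewrite -[leRHS]mulrA -!mulrDr ler_wpM2l ?sqr_ge0 // /E; lra.
lra.
Qed.

End one_step.

(** * Limits along filters and Fejer monotone sequences *)

Section limits.
Context {R : realType}.

(** If s is not eventually in a neighborhood B of l, the trace of F on the set where s avoids B is
    proper, and an ultrafilter refining it contradicts the assumption. *)
Lemma ultra_cvg {T : Type} (F : set_system T) (s : T -> R) (l : R) :
  ProperFilter F ->
  (forall U, UltraFilter U -> F `<=` U -> s t @[t --> U] --> l) ->
  s t @[t --> F] --> l.
Proof.
move=> Fproper cvU B Bl; apply: contrapT => nFB.
have Wproper : ProperFilter (within (~` (s @^-1` B)) F).
  split; last exact: within_filter.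
  move=> FB; apply: nFB; suff : F (s @^-1` B) by [].
  by apply: (filterS (F := F) _ FB) => t tB; apply: contrapT => /tB.
have [U [Uultra WU]] := ultraFilterLemma Wproper.
have Uproper : ProperFilter U by exact: ultra_proper.
have FU : F `<=` U.
  by move=> P FP; apply: WU; rewrite /within /=; apply: filterS FP => t Pt _.
have UB : U (s @^-1` B) by exact: cvU Bl.
have UC : U (~` (s @^-1` B)) by apply: WU; rewrite /within /=; apply: nearW.
have UBC : U (s @^-1` B `&` ~` (s @^-1` B)) by exact: filterI.
by have [t []] := filter_ex UBC.
Qed.

Lemma inner_cvg0 {T : Type} {H : hilbertType R} (F : set_system T)
    (a b : T -> H) (M : R) :
  Filter F -> (\forall t \near F, `|a t| <= M) -> `|b t| @[t --> F] --> 0 ->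
  '<[a t, b t]> @[t --> F] --> 0.
Proof.
move=> FF aM b0; apply/cvgrPdist_lt => e e0.
have M1 : 0 < `|M| + 1 by rewrite ltr_wpDl.
move/cvgrPdist_lt : b0 => /(_ _ (divr_gt0 e0 M1)).
apply: filterS2 aM => t at_M; rewrite !sub0r !normrN normr_id => bt.
apply: le_lt_trans (normr_inner _ _) _.
rewrite ltr_pdivlMr // in bt; apply: le_lt_trans bt.
rewrite mulrC ler_wpM2l // (le_trans at_M) // (le_trans (ler_norm _)) //.
by rewrite lerDl.
Qed.

Lemma sqr_le_cvg0 {T : Type} (F : set_system T) (s E : T -> R) :
  Filter F -> (forall t, 0 <= s t) -> (forall t, s t ^+ 2 <= E t) ->
  E t @[t --> F] --> 0 -> s t @[t --> F] --> 0.
Proof.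
move=> FF s0 sE E0; apply/cvgrPdist_lt => e e0.
have e20 : 0 < e ^+ 2 by rewrite exprn_gt0.
move/cvgrPdist_lt : E0 => /(_ _ e20).
apply: filterS => t; rewrite !sub0r !normrN => Et.
rewrite ger0_norm // -(ltr_pXn2r (n := 2)) ?nnegrE ?(ltW e0) //.
by apply: le_lt_trans (sE t) (le_lt_trans (ler_norm _) Et).
Qed.

(** D is nonincreasing and bounded below, hence converges, and E n is squeezed by the vanishing
    differences D n - D n.+1 divided by c. *)
Lemma fejer_cvg (D E : nat -> R) (c : R) :
  0 < c -> (forall n, 0 <= D n) -> (forall n, 0 <= E n) ->
  (forall n, D n.+1 <= D n - c * E n) ->
  [/\ cvg (D n @[n --> \oo]), forall n, D n <= D 0%N & E n @[n --> \oo] --> 0].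
Proof.
move=> c0 D0 E0 DE.
have Dn : {homo D : n m / (n <= m)%N >-> m <= n}.
  apply/nonincreasing_seqP => n; apply: le_trans (DE n) _.
  by rewrite gerBl mulr_ge0 // ltW.
have Dcvg : cvg (D n @[n --> \oo]).
  by apply: nonincreasing_is_cvgn => //; exists 0 => _ [n _ <-].
split=> // [n|]; first exact: Dn.
apply: (@squeeze_cvgr _ _ _ _ (cst 0) (fun n => c^-1 * (D n - D n.+1))).
- apply: nearW => n; rewrite E0 /= ler_pdivlMl //; have := DE n; lra.
- exact: cvg_cst.
- rewrite -(mulr0 c^-1) -(subrr (lim (D n @[n --> \oo]))).
  by apply: cvgMr; apply: cvgB => //; rewrite cvg_shiftS.
Qed.

Lemma weak_lsc_ultra {T : Type} {H : hilbertType R} (U : set_system T)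
    (s : T -> H) (x : H) (f : H -> \bar R) (c : R) :
  UltraFilter U -> Gamma0 f -> weak_cvg U s x ->
  (c%:E < f x)%E -> \forall t \near U, (c%:E < f (s t))%E.
Proof.
move=> Uultra f0 sx cx; have Uproper : ProperFilter U by exact: ultra_proper.
have [//|UC] := in_ultra_setVsetC [set t | (c%:E < f (s t))%E] Uultra.
suff : (f x <= c%:E)%E by rewrite leNgt cx.
apply: weak_lsc f0 sx _.
by apply: filterS UC => t /= /negP; rewrite -leNgt.
Qed.

(** Allows bounding a sum of values of f and g at a weak limit before these values are known to be
    finite. *)
Lemma lee_add_approx (X Y : \bar R) (K : R) :
  X != -oo%E -> Y != -oo%E ->
  (forall a b : R, (a%:E < X)%E -> (b%:E < Y)%E -> a + b <= K) ->
  (X + Y <= K%:E)%E.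
Proof.
case: X => [x||] //; case: Y => [y||] // _ _ hK.
- rewrite -EFinD lee_fin; apply/ler_addgt0Pr => e e0.
  suff : (x - 2^-1 * e) + (y - 2^-1 * e) <= K by lra.
  by apply: hK; rewrite lte_fin; lra.
- exfalso; suff : (x - 1) + (K - x + 2) <= K by lra.
  by apply: hK; [rewrite lte_fin; lra|rewrite ltry].
- exfalso; suff : (K - y + 2) + (y - 1) <= K by lra.
  by apply: hK; [rewrite ltry|rewrite lte_fin; lra].
- exfalso; suff : (K + 1) + 0 <= K by lra.
  by apply: hK; rewrite ltry.
Qed.

End limits.

(** * Weak limits of the iterates are Kuhn-Tucker pairs *)

Section weak_limits.
Context {R : realType}.

Lemma weak_cvg_unique {T : Type} {H : hilbertType R} (F : set_system T)
    (s : T -> H) (x y : H) :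
  ProperFilter F -> weak_cvg F s x -> weak_cvg F s y -> x = y.
Proof.
move=> Fproper sx sy; apply/eqP; rewrite -subr_eq0 -normr_eq0 -sqrf_eq0.
rewrite sqr_normE innerDl innerNl subr_eq0; apply/eqP.
exact: (cvg_unique _ (sx (x - y)) (sy (x - y))).
Qed.

Lemma weak_cvg_equiv {T : Type} {H : hilbertType R} (F : set_system T)
    (s s' : T -> H) (x : H) :
  Filter F -> weak_cvg F s x -> `|s t - s' t| @[t --> F] --> 0 ->
  weak_cvg F s' x.
Proof.
move=> FF sx ss' u.
rewrite (_ : (fun t => _) = (fun t => '<[s t, u]> - '<[u, s t - s' t]>));
  last first.
  by apply/funext => t; rewrite !innerE !(inner_sym u); lra.
rewrite -[X in _ --> X]subr0; apply: cvgB; first exact: sx.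
by apply: (@inner_cvg0 _ _ _ _ _ _ `|u|) => //; exact: nearW.
Qed.

Lemma weak_cvg_linear {T : Type} {H G : hilbertType R} (L : {linear H -> G})
    (F : set_system T) (s : T -> H) (x : H) :
  bounded_fun_norm L -> weak_cvg F s x -> weak_cvg F (L \o s) (L x).
Proof.
move=> Lb sx u; rewrite inner_adjoint //.
rewrite (_ : (fun t => _) = (fun t => '<[s t, adjoint L u]>)); first exact: sx.
by apply/funext => t; rewrite /= inner_adjoint.
Qed.

Context {H G : hilbertType R} (f : H -> \bar R) (g : G -> \bar R).
Context (L : {linear H -> G}).
Context (hf : Gamma0 f) (hg : Gamma0 g) (Lbounded : bounded_fun_norm L).

(** The terms in v are regrouped so that v is paired only with the fixed b - L a and with L p - q,
    which tends to 0. No product of two merely weakly convergent sequences remains. *)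
Lemma subdifferential_leD (p x a : H) (q y b v : G) (c : R) :
  subdifferential f p (c^-1 *: (x - c *: adjoint L v - p)) ->
  subdifferential g q (c^-1 *: (y + c *: v - q)) -> c != 0 ->
  (f p + g q + ('<[a - p, c^-1 *: (x - p)]> + '<[b - q, c^-1 *: (y - q)]>
     + '<[b - L a, v]> + '<[v, L p - q]>)%:E <= f a + g b)%E.
Proof.
move=> fp gq c0.
have pE : c^-1 *: (x - c *: adjoint L v - p) = c^-1 *: (x - p) - adjoint L v.
  by rewrite addrAC scalerBr scalerA mulVf // scale1r.
have qE : c^-1 *: (y + c *: v - q) = c^-1 *: (y - q) + v.
  by rewrite addrAC scalerDr scalerA mulVf // scale1r.
have := leeD (fp a) (gq b).
rewrite pE qE addeACA addeC -EFinD; congr (_ + _%:E <= _)%E.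
rewrite !innerE -!inner_adjoint // (inner_sym v (L p)) (inner_sym v q).
ring.
Qed.

Lemma weak_limit_kuhn_tucker {T : Type} (U : set_system T) (x p : T -> H)
    (y q v : T -> G) (c : T -> R) (e M : R) (xh : H) (yh vh : G) :
  UltraFilter U -> 0 < e -> (forall t, e <= c t) ->
  (forall t, subdifferential f (p t)
     ((c t)^-1 *: (x t - c t *: adjoint L (v t) - p t))) ->
  (forall t, subdifferential g (q t)
     ((c t)^-1 *: (y t + c t *: v t - q t))) ->
  (forall t, `|x t| <= M) -> (forall t, `|y t| <= M) ->
  (forall t, `|v t| <= M) ->
  `|x t - p t| @[t --> U] --> 0 -> `|y t - q t| @[t --> U] --> 0 ->
  `|L (x t) - y t| @[t --> U] --> 0 ->
  weak_cvg U x xh -> weak_cvg U y yh -> weak_cvg U v vh ->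
  yh = L xh /\ kuhn_tucker f g L xh vh.
Proof.
move=> Uultra e0 ec fp gq xM yM vM xp yq Lxy xxh yyh vvh.
have Uproper : ProperFilter U by exact: ultra_proper.
have yE : yh = L xh.
  apply: (weak_cvg_unique Uproper yyh).
  exact: weak_cvg_equiv (weak_cvg_linear Lbounded xxh) Lxy.
split=> //; subst yh.
have pxh : weak_cvg U p xh by exact: weak_cvg_equiv xxh xp.
have qyh : weak_cvg U q (L xh) by exact: weak_cvg_equiv yyh yq.
have Lpq : `|L (p t) - q t| @[t --> U] --> 0.
  apply: (@squeeze_cvgr _ _ _ _ (cst 0)
    (fun t => opnorm L * `|x t - p t| + `|L (x t) - y t| + `|y t - q t|)).
  - apply: nearW => t; rewrite normr_ge0 /=.
    have -> : L (p t) - q t = L (p t - x t) + (L (x t) - y t) + (y t - q t).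
      by rewrite linearB /= !addrA !subrK.
    apply: (le_trans (ler_normD _ _)); rewrite lerD2r.
    apply: (le_trans (ler_normD _ _)); rewrite lerD2r distrC.
    exact: ler_opnorm.
  - exact: cvg_cst.
  - rewrite -[X in _ --> X](addr0 (0 : R)) -[X in _ --> X + _](addr0 (0 : R)).
    rewrite -[X in _ --> X + _ + _](mulr0 (opnorm L)).
    by apply: cvgD => //; apply: cvgD => //; apply: cvgMr.
(* For p and q only an eventual bound is available, from being within 1 of x and y. *)
have near_bnd (K : hilbertType R) (s s' : T -> K) (a : K) :
    (forall t, `|s t| <= M) -> `|s t - s' t| @[t --> U] --> 0 ->
    \forall t \near U, `|a - s' t| <= `|a| + M + 1.
  move=> sM /cvgrPdist_lt /(_ _ ltr01); apply: filterS => t.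
  rewrite sub0r normrN normr_id => ss'.
  have -> : a - s' t = a - s t + (s t - s' t) by rewrite addrA subrK.
  apply: (le_trans (ler_normD _ _)); rewrite lerD ?(ltW ss') //.
  by apply: (le_trans (ler_normB _ _)); rewrite lerD.
have scaled0 (K : hilbertType R) (s : T -> K) :
    `|s t| @[t --> U] --> 0 -> `|(c t)^-1 *: s t| @[t --> U] --> 0.
  move=> s0; apply: (@squeeze_cvgr _ _ _ _ (cst 0) (fun t => e^-1 * `|s t|)).
  - apply: nearW => t; rewrite normr_ge0 /= normrZ ler_wpM2r // normfV.
    have ct : 0 < c t by exact: lt_le_trans (ec t).
    by rewrite gtr0_norm // lef_pV2 ?posrE.
  - exact: cvg_cst.
  - by rewrite -(mulr0 e^-1); apply: cvgMr.
(* The joint inequality in the limit. Taking b = L xh will give the inclusion for f, and a = xh the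
   one for g. *)
have main (a : H) (b : G) : (f a < +oo)%E -> (g b < +oo)%E ->
    (f xh + g (L xh) <= f a + g b - '<[b - L a, vh]>%:E)%E.
  move=> fa gb.
  have faE := fineK (Gamma0_fin hf fa); have gbE := fineK (Gamma0_fin hg gb).
  rewrite -faE -gbE -(EFinD (fine (f a))) -EFinB.
  have [fNoo _ _ _] := hf; have [gNoo _ _ _] := hg.
  apply: lee_add_approx => // s1 s2 hs1 hs2.
  rewrite lerBrDr.
  pose S t := '<[a - p t, (c t)^-1 *: (x t - p t)]> +
    '<[b - q t, (c t)^-1 *: (y t - q t)]> + '<[b - L a, v t]> +
    '<[v t, L (p t) - q t]>.
  have S0 : S t @[t --> U] --> '<[b - L a, vh]>.
    rewrite -[X in _ --> X]addr0 -[X in _ --> X + _]add0r.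
    rewrite -[X in _ --> X + _ + _]addr0.
    apply: cvgD; last by apply: inner_cvg0 Lpq; exact: nearW vM.
    apply: cvgD; last first.
      rewrite inner_sym.
      by under eq_fun do rewrite inner_sym; exact: vvh.
    by apply: cvgD; apply: inner_cvg0 (near_bnd _ _ _ _ _ _) (scaled0 _ _ _).
  apply: (cvgr_to_le (cvgD (cvg_cst (s1 + s2)) S0)).
  have f1 := weak_lsc_ultra Uultra hf pxh hs1.
  have f2 := weak_lsc_ultra Uultra hg qyh hs2.
  apply: filterS2 f1 f2 => t f1 f2.
  suff : ((s1%:E + s2%:E) + (S t)%:E <= f a + g b)%E.
    by rewrite -faE -gbE -!EFinD lee_fin.
  have ct : c t != 0 by rewrite gt_eqF // (lt_le_trans e0).
  apply: le_trans (subdifferential_leD a b (fp t) (gq t) ct).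
  by apply: leeD2r; apply: leeD; apply: ltW.
have [_ [a0 fa0] _ _] := hf; have [_ [b0 gb0] _ _] := hg.
(* Domain points a0 and b0 make the right side of [main] real; only then may xh and L xh themselves
   be inserted. *)
have [fxh gxh] : (f xh < +oo)%E /\ (g (L xh) < +oo)%E.
  have [fNoo _ _ _] := hf; have [gNoo _ _ _] := hg.
  have := main _ _ fa0 gb0.
  rewrite -(fineK (Gamma0_fin hf fa0)) -(fineK (Gamma0_fin hg gb0)).
  rewrite -(EFinD (fine (f a0))) -EFinB.
  case: (f xh) (fNoo xh) => [s||] // _;
    case: (g (L xh)) (gNoo (L xh)) => [s'||] // _ _.
  by rewrite !ltry.
have fxE := fineK (Gamma0_fin hf fxh); have gxE := fineK (Gamma0_fin hg gxh).
split=> [a|b].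
  have [fa|] := ltP (f a) +oo%E; last first.
    by rewrite leye_eq => /eqP ->; rewrite leey.
  have := main _ _ fa gxh; rewrite -fxE -gxE -(fineK (Gamma0_fin hf fa)).
  rewrite -!EFinB -!EFinD !lee_fin innerNr -inner_adjoint // linearB /= !innerE.
  lra.
have [gb|] := ltP (g b) +oo%E; last first.
  by rewrite leye_eq => /eqP ->; rewrite leey.
have := main _ _ fxh gb; rewrite -fxE -gxE -(fineK (Gamma0_fin hg gb)).
rewrite -!EFinB -!EFinD !lee_fin; lra.
Qed.

End weak_limits.

(** * Opial's argument and convergence of the iteration *)

Lemma opial_triple {R : realType} {H G : hilbertType R}
    (x : nat -> H) (y v : nat -> G) (U1 U2 : set_system nat)
    (a1 a2 : H) (b1 b2 c1 c2 : G) :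
  UltraFilter U1 -> \oo `<=` U1 -> UltraFilter U2 -> \oo `<=` U2 ->
  weak_cvg U1 x a1 -> weak_cvg U1 y b1 -> weak_cvg U1 v c1 ->
  weak_cvg U2 x a2 -> weak_cvg U2 y b2 -> weak_cvg U2 v c2 ->
  cvg (`|x n - a1| ^+ 2 + `|y n - b1| ^+ 2 + `|v n - c1| ^+ 2 @[n --> \oo]) ->
  cvg (`|x n - a2| ^+ 2 + `|y n - b2| ^+ 2 + `|v n - c2| ^+ 2 @[n --> \oo]) ->
  a1 = a2 /\ c1 = c2.
Proof.
move=> U1u U1oo U2u U2oo xa1 yb1 vc1 xa2 yb2 vc2 D1 D2.
have U1p : ProperFilter U1 by exact: ultra_proper.
have U2p : ProperFilter U2 by exact: ultra_proper.
pose psi n : R := '<[x n, a2 - a1]> + '<[y n, b2 - b1]> + '<[v n, c2 - c1]>.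
have [l psil] : exists l : R, psi n @[n --> \oo] --> l.
  (* The squares of the iterates cancel in d1 - d2, which equals 2 * psi - K; so psi converges along
     the whole sequence. *)
  pose K := `|a2| ^+ 2 - `|a1| ^+ 2 + (`|b2| ^+ 2 - `|b1| ^+ 2)
    + (`|c2| ^+ 2 - `|c1| ^+ 2).
  set d1 := (X in cvg (X @ _)) in D1; set d2 := (X in cvg (X @ _)) in D2.
  exists (2^-1 * (lim (d1 n @[n --> \oo]) - lim (d2 n @[n --> \oo]) + K)).
  rewrite (_ : psi = fun n => 2^-1 * (d1 n - d2 n + K)).
    by apply: cvgMr; apply: cvgD; [exact: cvgB|exact: cvg_cst].
  apply/funext => n; rewrite /psi /K /d1 /d2 !sqr_normE !innerE.
  rewrite !(inner_sym _ (x n)) !(inner_sym _ (y n)) !(inner_sym _ (v n)).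
  lra.
have psi1 : psi n @[n --> U1] -->
    '<[a1, a2 - a1]> + '<[b1, b2 - b1]> + '<[c1, c2 - c1]>.
  by apply: cvgD; [apply: cvgD; [exact: xa1|exact: yb1]|exact: vc1].
have psi2 : psi n @[n --> U2] -->
    '<[a2, a2 - a1]> + '<[b2, b2 - b1]> + '<[c2, c2 - c1]>.
  by apply: cvgD; [apply: cvgD; [exact: xa2|exact: yb2]|exact: vc2].
have l1 : '<[a1, a2 - a1]> + '<[b1, b2 - b1]> + '<[c1, c2 - c1]> = l.
  apply: (cvg_unique _ psi1) => // B Bl.
  exact: U1oo (psil B Bl).
have l2 : '<[a2, a2 - a1]> + '<[b2, b2 - b1]> + '<[c2, c2 - c1]> = l.
  apply: (cvg_unique _ psi2) => // B Bl.
  exact: U2oo (psil B Bl).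
(* The left sides of l2 and l1 differ by exactly this sum. *)
have e0 : `|a2 - a1| ^+ 2 + `|b2 - b1| ^+ 2 + `|c2 - c1| ^+ 2 = 0.
  move: l1 l2; rewrite !sqr_normE !innerE; lra.
have n1 := sqr_ge0 `|a2 - a1|; have n2 := sqr_ge0 `|b2 - b1|.
have n3 := sqr_ge0 `|c2 - c1|.
have eq0 (K : hilbertType R) (s t : K) : `|s - t| ^+ 2 = 0 -> t = s.
  by move=> /eqP; rewrite sqrf_eq0 normr_eq0 subr_eq0 => /eqP.
by split; apply: eq0; lra.
Qed.

Lemma ler_add3 {R : numDomainType} (a b c : R) :
  0 <= a -> 0 <= b -> 0 <= c ->
  [/\ a <= a + b + c, b <= a + b + c & c <= a + b + c].
Proof.
move=> a0 b0 c0; split; last by rewrite lerDr addr_ge0.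
- by rewrite -addrA lerDl addr_ge0.
- by rewrite addrAC lerDr addr_ge0.
Qed.

Theorem proposition4p9 (R : realType) (H G : hilbertType R)
    (f : H -> \bar R) (g : G -> \bar R) (L : {linear H -> G})
    (hf : Gamma0 f) (hg : Gamma0 g)
    (Lbounded : bounded_fun_norm L) (Lneq0 : exists x, L x <> 0)
    (hran : op_ran (op_add (subdifferential f)
                           (op_comp (adjoint L) (subdifferential g) L)) 0)
    (x : nat -> H) (y v : nat -> G)
    (p : nat -> H) (r q : nat -> G)
    (eps : R) (gamma : nat -> R)
    (heps : 0 < eps < 1 / (1 + Num.sqrt (1 + opnorm L ^+ 2)))
    (hgamma : forall n,
      eps <= gamma n <= (1 - eps) / Num.sqrt (1 + opnorm L ^+ 2))
    (hr : forall n, r n = gamma n *: (L (x n) - y n))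
    (hp : forall n, p n = prox (fun z => ((gamma n)%:E * f z)%E)
                               (x n - gamma n *: adjoint L (v n)))
    (hq : forall n, q n = prox (fun z => ((gamma n)%:E * g z)%E)
                               (y n + gamma n *: v n))
    (hx : forall n, x n.+1 = p n - gamma n *: adjoint L (r n))
    (hy : forall n, y n.+1 = q n + gamma n *: r n)
    (hv : forall n, v n.+1 = v n + gamma n *: (L (p n) - q n)) :
  (exists2 xs : H,
     argmin (fun z => (f z + g (L z))%E) xs & weakly_converges x xs) /\
  (exists2 vs : G,
     argmin (fun w => (conjugate f (- adjoint L w)%R + conjugate g w)%E) vs &
     weakly_converges v vs).
Proof.
have [xb [vb KTb]] := kuhn_tucker_ex hran.
have [fxb gxb] := KTb.
have /andP[eps0 epslt] := heps.
have eps1 : eps < 1.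
  have := sqrtr_ge0 (1 + opnorm L ^+ 2) => s0.
  by apply: lt_le_trans epslt _; rewrite ler_pdivrMr ?mul1r; lra.
have gamma0 n : 0 < gamma n by have /andP[+ _] := hgamma n; exact: lt_le_trans.
have fp n : subdifferential f (p n)
    ((gamma n)^-1 *: (x n - gamma n *: adjoint L (v n) - p n)).
  have [_] := prox_subdifferential (x n - gamma n *: adjoint L (v n))
                (gamma0 n) hf fxb.
  by rewrite -hp.
have gq n : subdifferential g (q n)
    ((gamma n)^-1 *: (y n + gamma n *: v n - q n)).
  have [_] := prox_subdifferential (y n + gamma n *: v n) (gamma0 n) hg gxb.
  by rewrite -hq.
pose D (a : H) (b : G) n :=
  `|x n - a| ^+ 2 + `|y n - L a| ^+ 2 + `|v n - b| ^+ 2.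
pose E n := `|x n - p n| ^+ 2 + `|y n - q n| ^+ 2 + `|r n| ^+ 2.
have c0 : 0 < 1 - (1 - eps) ^+ 2 by nra.
have fejer a b : kuhn_tucker f g L a b ->
    [/\ cvg (D a b n @[n --> \oo]), forall n, D a b n <= D a b 0%N
      & E n @[n --> \oo] --> 0].
  have e01 : 0 < eps < 1 by rewrite eps0.
  move=> KT; apply: (fejer_cvg c0) => [n|n|n]; rewrite ?addr_ge0 ?sqr_ge0 //.
  rewrite /D hx hy hv; have /andP[_ gammale] := hgamma n.
  exact: (fejer_step hf hg Lbounded KT e01 (gamma0 n) gammale (fp n) (gq n)
           (hr n)).
have [_ Dle E0] := fejer _ _ KTb.
(* One bound for all three sequences; t <= t ^+ 2 + 1 turns the bound on squared distances into one
   on distances. *)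
pose M := D xb vb 0%N + 1 + (`|xb| + `|L xb| + `|vb|).
have bounded (K : hilbertType R) (s : nat -> K) (b : K) :
    (forall n, `|s n - b| ^+ 2 <= D xb vb n) ->
    `|b| <= `|xb| + `|L xb| + `|vb| -> forall n, `|s n| <= M.
  move=> sD bM n; rewrite -[s n](subrK b); apply: (le_trans (ler_normD _ _)).
  apply: lerD bM.
  have := le_trans (sD n) (Dle n); have := sqr_ge0 (`|s n - b| - 1).
  have := sqr_ge0 `|s n - b|; lra.
have [nx ny nv] := ler_add3 (normr_ge0 xb) (normr_ge0 (L xb)) (normr_ge0 vb).
have D3 n := ler_add3 (sqr_ge0 `|x n - xb|) (sqr_ge0 `|y n - L xb|)
               (sqr_ge0 `|v n - vb|).
have xM n : `|x n| <= M.
  by apply: (bounded _ x xb) => // k; have [] := D3 k.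
have yM n : `|y n| <= M.
  by apply: (bounded _ y (L xb)) => // k; have [] := D3 k.
have vM n : `|v n| <= M.
  by apply: (bounded _ v vb) => // k; have [] := D3 k.
have E3 n := ler_add3 (sqr_ge0 `|x n - p n|) (sqr_ge0 `|y n - q n|)
               (sqr_ge0 `|r n|).
have xp : `|x n - p n| @[n --> \oo] --> 0.
  by apply: (sqr_le_cvg0 _ _ _ E0) => [n|n]; [|have [] := E3 n].
have yq : `|y n - q n| @[n --> \oo] --> 0.
  by apply: (sqr_le_cvg0 _ _ _ E0) => [n|n]; [|have [] := E3 n].
have r0 : `|r n| @[n --> \oo] --> 0.
  by apply: (sqr_le_cvg0 _ _ _ E0) => [n|n]; [|have [] := E3 n].
have Lxy : `|L (x n) - y n| @[n --> \oo] --> 0.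
  apply: (@squeeze_cvgr _ _ _ _ (cst 0) (fun n => eps^-1 * `|r n|)).
  - apply: nearW => n; rewrite normr_ge0 /= hr normrZ (gtr0_norm (gamma0 n)).
    rewrite ler_pdivlMl // ler_wpM2r //; by have /andP[] := hgamma n.
  - exact: cvg_cst.
  - by rewrite -(mulr0 eps^-1); apply: cvgMr.
have cluster U : UltraFilter U -> \oo `<=` U -> exists a b,
    [/\ kuhn_tucker f g L a b, weak_cvg U x a, weak_cvg U y (L a)
      & weak_cvg U v b].
  move=> Uultra Uoo.
  have sub (s : nat -> R) (l : R) :
      s n @[n --> \oo] --> l -> s n @[n --> U] --> l.
    by move=> sl B Bl; apply: Uoo; exact: sl.
  have [xh xxh] := ultra_weak_cvg Uultra xM.
  have [yh yyh] := ultra_weak_cvg Uultra yM.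
  have [vh vvh] := ultra_weak_cvg Uultra vM.
  have [yE KT] : yh = L xh /\ kuhn_tucker f g L xh vh.
    apply: (weak_limit_kuhn_tucker hf hg Lbounded Uultra eps0 _ fp gq xM yM vM
             (sub _ _ xp) (sub _ _ yq) (sub _ _ Lxy) xxh yyh vvh).
    by move=> n; have /andP[] := hgamma n.
  by subst yh; exists xh, vh.
(* One ultrafilter fixes the candidate limits; Opial's argument shows that every other one gives the
   same. *)
have [U0 [U0ultra U0oo]] := ultraFilterLemma (F := \oo) _.
have [xs [vs [KTs xs0 ys0 vs0]]] := cluster _ U0ultra U0oo.
have [Ds _ _] := fejer _ _ KTs.
have limits U : UltraFilter U -> \oo `<=` U ->
    weak_cvg U x xs /\ weak_cvg U v vs.
  move=> Uultra Uoo; have [a [b [KT xa ya vb']]] := cluster U Uultra Uoo.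
  have [Da _ _] := fejer _ _ KT.
  by have [-> ->] := opial_triple U0ultra U0oo Uultra Uoo
                       xs0 ys0 vs0 xa ya vb' Ds Da.
split.
- exists xs; first exact: kuhn_tucker_primal KTs.
  by move=> u; apply: ultra_cvg => U Uultra Uoo; exact: (limits U Uultra Uoo).1.
- exists vs; first exact: kuhn_tucker_dual KTs.
  by move=> u; apply: ultra_cvg => U Uultra Uoo; exact: (limits U Uultra Uoo).2.
Qed.
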